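(* Let $M$ be a matroid on $[n]$, $I\subseteq[n]$, and $w\in\mathbb{R}^n$ with pairwise distinct coordinates. (a) If some $i\in I$ is a loop of $M$, then $\Delta_w(M,I)=\emptyset$. (b) If $i\in I$ is a coloop of $M$, then $\Delta_w(M,I)=\mathrm{cone}(\Delta_w(M/i,I\setminus i),i)$. (c) If $i=\max(I)$ (in the order induced by $w$) is neither a loop nor a coloop of $M$, then $\Delta_w(M,I)=\Delta_w(M\setminus i,I\setminus i)\cup\mathrm{cone}(\Delta_w(M/i,I\setminus i),i)$.
   Context: $w$ orders $[n]$ by $i<j$ iff $w_i<w_j$ (and restricts to an order on any subset). For a circuit $C$ of $M$, the $I$-broken circuit is $b_I(C)=C\setminus\min(C)$ if $C\subseteq I$, and $b_I(C)=(C\cap I)\cup\{\max(C\setminus I)\}$ if $C\not\subseteq I$. $\Delta_w(M,I)$ is the collection of all $\tau\subseteq[n]$ (ground set of $M$) containing no $I$-broken circuit of $M$; for $M\setminus i$ and $M/i$ the ground set is $[n]\setminus\{i\}$ with the restricted order. $M\setminus i$ and $M/i$ denote deletion and contraction. For a simplicial complex $\Delta$ on $[n]\setminus\{i\}$, $\mathrm{cone}(\Delta,i)=\Delta\cup\{S\cup\{i\}:S\in\Delta\}$. *)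

(* Defs.v *)
From mathcomp Require Import all_boot all_order all_algebra.
From mathcomp Require Import reals.

Set Implicit Arguments.
Unset Strict Implicit.
Unset Printing Implicit Defensive.

Import Order.TTheory GRing.Theory Num.Theory.

Local Open Scope ring_scope.

(* The ground set [E] is a subset of an ambient finite type, so that a matroid
   on [n] and its minors on [n] \ {i} all live over 'I_n and a single weight
   vector orders all their ground sets. *)
Record matroid (T : finType) (E : {set T}) := Matroid {
  indep : {set {set T}};
  indep_ground : forall S : {set T}, S \in indep -> S \subset E;
  indep_set0 : set0 \in indep;
  indep_sub : forall S S' : {set T}, S \in indep -> S' \subset S -> S' \in indep;
  indep_aug : forall S S' : {set T}, S \in indep -> S' \in indep -> (#|S| < #|S'|)%N ->
    exists2 x, x \in S' :\: S & x |: S \in indep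
}.

Section Matroid.
Variables (T : finType) (E : {set T}) (M : matroid E).

Definition circuit (C : {set T}) : bool :=
  minset [pred D : {set T} | (D \subset E) && (D \notin indep M)] C.

Definition basis (B : {set T}) : bool :=
  maxset [pred D : {set T} | D \in indep M] B.

Definition loop (i : T) : bool := circuit [set i].

Definition coloop (i : T) : bool := [forall B, basis B ==> (i \in B)].

Definition del_indep (i : T) : {set {set T}} :=
  [set S in indep M | S \subset E :\ i].

Fact del_ground i (S : {set T}) : S \in del_indep i -> S \subset E :\ i.
Proof. by rewrite inE => /andP[]. Qed.

Fact del_set0 i : set0 \in del_indep i.
Proof. by rewrite inE indep_set0 sub0set. Qed.

Fact del_sub i (S S' : {set T}) : S \in del_indep i -> S' \subset S -> S' \in del_indep i.
Proof.
rewrite !inE => /andP[iS sSE] sS'S.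
by rewrite (indep_sub iS sS'S) (subset_trans sS'S sSE).
Qed.

Fact del_aug i (S S' : {set T}) : S \in del_indep i -> S' \in del_indep i ->
  (#|S| < #|S'|)%N -> exists2 x, x \in S' :\: S & x |: S \in del_indep i.
Proof.
rewrite !inE => /andP[iS sSE] /andP[iS' sS'E] ltSS'.
have [x xS'S ixS] := indep_aug iS iS' ltSS'; exists x => //.
rewrite inE ixS subUset sub1set sSE andbT (subsetP sS'E) //.
by case/setDP: xS'S.
Qed.

Definition deletion (i : T) : matroid (E :\ i) :=
  @Matroid T (E :\ i) (del_indep i)
    (@del_ground i) (del_set0 i) (@del_sub i) (@del_aug i).

(* A basis of the restriction of [M] to {i}: contracting a loop deletes it. *)
Definition basis1 (i : T) : {set T} :=
  if [set i] \in indep M then [set i] else set0.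

Definition con_indep (i : T) : {set {set T}} :=
  [set S : {set T} | (S \subset E :\ i) && (S :|: basis1 i \in indep M)].

Fact con_ground i (S : {set T}) : S \in con_indep i -> S \subset E :\ i.
Proof. by rewrite inE => /andP[]. Qed.

Fact con_set0 i : set0 \in con_indep i.
Proof.
by rewrite inE sub0set set0U /basis1; case: ifP => // _; apply: indep_set0.
Qed.

Fact con_sub i (S S' : {set T}) : S \in con_indep i -> S' \subset S -> S' \in con_indep i.
Proof.
rewrite !inE => /andP[sSE iS] sS'S; rewrite (subset_trans sS'S sSE) /=.
by apply: indep_sub iS _; apply: setSU.
Qed.

Fact card_con i (S : {set T}) :
  S \subset E :\ i -> #|S :|: basis1 i| = (#|S| + #|basis1 i|)%N.
Proof.
move=> sSE; apply/eqP; rewrite (leq_card_setU _ _).2.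
rewrite disjoint_sym; apply: (@disjointWl _ _ (mem [set i])).
  by rewrite /basis1; case: ifP => // _; apply: sub0set.
by rewrite disjoints1; apply/negP => /(subsetP sSE); rewrite setD11.
Qed.

Fact con_aug i (S S' : {set T}) : S \in con_indep i -> S' \in con_indep i ->
  (#|S| < #|S'|)%N -> exists2 x, x \in S' :\: S & x |: S \in con_indep i.
Proof.
rewrite !inE => /andP[sSE iS] /andP[sS'E iS'] ltSS'.
have lt: (#|S :|: basis1 i| < #|S' :|: basis1 i|)%N.
  by rewrite !card_con // ltn_add2r.
have [x] := indep_aug iS iS' lt.
rewrite !inE negb_or => /andP[/andP[xS xB]]; rewrite (negPf xB) orbF => xS'.
rewrite setUA => ixS; exists x; first by rewrite !inE xS.
by rewrite inE ixS subUset sub1set sSE (subsetP sS'E).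
Qed.

Definition contraction (i : T) : matroid (E :\ i) :=
  @Matroid T (E :\ i) (con_indep i)
    (@con_ground i) (con_set0 i) (@con_sub i) (@con_aug i).

End Matroid.

Section BrokenCircuit.
Variables (R : realType) (T : finType) (w : T -> R).
Implicit Types (A I C : {set T}).

(* [wmin] and [wmax] are the sets of [w]-smallest and [w]-largest elements;
   for injective [w] and nonempty [A] they are the singletons {min(A)} and
   {max(A)}, see [wmin1] and [wmax1]. *)
Definition wmin A : {set T} := [set x in A | [forall y in A, w x <= w y]].
Definition wmax A : {set T} := [set x in A | [forall y in A, w y <= w x]].

Lemma wmin1 A : injective w -> A != set0 -> exists x, wmin A = [set x].
Proof.
move=> w_inj /set0Pn[a aA].
case: (arg_minP w aA) => x xA min_x.
exists x; apply/setP => y; rewrite !inE; apply/andP/eqP => [[yA /forall_inP my]|->].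
  by apply/w_inj/le_anti; rewrite my // min_x.
by split=> //; apply/forall_inP.
Qed.

Lemma wmax1 A : injective w -> A != set0 -> exists x, wmax A = [set x].
Proof.
move=> w_inj /set0Pn[a aA].
case: (arg_maxP w aA) => x xA max_x.
exists x; apply/setP => y; rewrite !inE; apply/andP/eqP => [[yA /forall_inP my]|->].
  by apply/w_inj/le_anti; rewrite my // andbT; apply: max_x.
by split=> //; apply/forall_inP.
Qed.

Definition broken I C : {set T} :=
  if C \subset I then C :\: wmin C else (C :&: I) :|: wmax (C :\: I).

Definition broken_complex (E : {set T}) (M : matroid E) I : {set {set T}} :=
  [set tau : {set T} | (tau \subset E) &&
    [forall C, circuit M C ==> ~~ (broken I C \subset tau)]].

End BrokenCircuit.

Definition cone (T : finType) (D : {set {set T}}) (i : T) : {set {set T}} :=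
  D :|: [set i |: S | S in D].

(* Main.v *)
Require Import Defs.
From mathcomp Require Import all_boot all_order all_algebra.
From mathcomp Require Import reals.

Set Implicit Arguments.
Unset Strict Implicit.
Unset Printing Implicit Defensive.

Local Open Scope ring_scope.

(** If [i] is a coloop, then [M] and [M / i] have the same circuits.  If
    [i = max I] is neither a loop nor a coloop, then [i] lies in [broken I C]
    for every circuit [C] through [i], so the faces avoiding [i] are those of
    [M \ i].  The faces through [i] are [i |: tau] with [tau] a face of [M / i]:
    a circuit of [M / i] comes from a circuit of [M] by removing [i] at most, and
    conversely a circuit [C] of [M] avoiding [i] contains a circuit [C'] of
    [M / i] through the element [max (C :\: I)], hence with
    [broken I C' \subset broken I C]. *)

Import Order.TTheory.

Lemma setD1_id (T : finType) (i : T) (S : {set T}) : i \notin S -> S :\ i = S.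
Proof. by move=> iS; apply/setDidPl; rewrite disjoint_sym disjoints1. Qed.

Lemma eq_circuit (T : finType) (E : {set T}) (M N : matroid E) :
  indep M =i indep N -> circuit M =1 circuit N.
Proof.
by move=> /setP eqMN C; rewrite /circuit eqMN.
Qed.

(** * Circuits as minimal dependent sets *)

Section Circuits.
Variables (T : finType) (E : {set T}) (M : matroid E).
Implicit Types (C D S : {set T}).

Lemma circuitP C :
  reflect [/\ C \subset E, C \notin indep M &
              forall D, D \proper C -> D \in indep M]
          (circuit M C).
Proof.
apply: (iffP minsetP) => [[/andP[CE nC] minC]|[CE nC minC]].
  split=> // D ltDC; apply: contraT => nD.
  have sDC := proper_sub ltDC.
  have DC: D = C by apply: minC => //=; rewrite (subset_trans sDC CE).
  by rewrite DC properxx in ltDC.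
split=> [|D /andP[_ nD] sDC]; first by rewrite /= CE.
apply/eqP; rewrite eqEproper sDC /=.
by apply: contra nD => /minC.
Qed.

Lemma circuit_sub_dep S :
  S \subset E -> S \notin indep M -> exists2 C, circuit M C & C \subset S.
Proof.
move=> SE nS.
have [|C minC sCS] := @minset_exists _ [pred D : {set T} | (D \subset E) && (D \notin indep M)] S.
  by rewrite /= SE.
by exists C.
Qed.

Lemma circuit_neq0 C : circuit M C -> C != set0.
Proof. by case/circuitP=> _ nC _; apply: contra nC => /eqP->; apply: indep_set0. Qed.

End Circuits.

(** * Circuits of deletions and contractions *)

Section Matroids.
Variables (T : finType) (E : {set T}) (M : matroid E).
Implicit Types (C D S : {set T}) (i m : T).

Lemma nonloop_indep i : i \in E -> ~~ loop M i -> [set i] \in indep M.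
Proof.
move=> iE; apply: contraR => ni; apply/circuitP; split; rewrite ?sub1set //.
move=> D; rewrite properEcard cards1 ltnS leqn0 cards_eq0 => /andP[_ /eqP->].
exact: indep_set0.
Qed.

(** Extend [S] to a basis: it contains the coloop [i], hence all of [i |: S]. *)
Lemma coloop_indepU1 i S : coloop M i -> S \in indep M -> i |: S \in indep M.
Proof.
move=> /forallP coi iS.
have [|B maxB sSB] := @maxset_exists _ [pred D : {set T} | D \in indep M] S; first exact: iS.
have iB: i \in B by have /implyP-> := coi B.
by apply: (indep_sub (maxsetp maxB)); rewrite subUset sub1set iB.
Qed.

Lemma coloop_notin_circuit i C : coloop M i -> circuit M C -> i \notin C.
Proof.
move=> coi /circuitP[_ nC minC]; apply: contra nC => iC.
by rewrite -(setD1K iC) coloop_indepU1 // minC // properD1.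
Qed.

Lemma circuit_deletion i C :
  circuit (deletion M i) C = circuit M C && (i \notin C).
Proof.
apply/minsetP/andP.
  case=> /andP[]; rewrite /= subsetD1 inE subsetD1 => /andP[CE iC].
  rewrite CE iC !andbT => nC minC; split=> //; apply/minsetP; split=> [|D].
    by rewrite /= CE.
  move=> /andP[DE nD] sDC; apply: minC => //=.
  have iD : i \notin D by apply: contra iC => /(subsetP sDC).
  by rewrite inE (negPf nD) subsetD1 DE iD.
case=> /minsetP[/andP[CE nC] minC] iC.
split=> [|D]; first by rewrite /= inE subsetD1 CE iC (negPf nC).
rewrite /= inE subsetD1 => /andP[/andP[DE iD]].
by rewrite DE iD !andbT => nD; apply: minC; rewrite /= DE.
Qed.

Lemma con_indepE i S : [set i] \in indep M ->
  (S \in indep (contraction M i)) = (S \subset E :\ i) && (i |: S \in indep M).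
Proof. by move=> ii; rewrite inE /basis1 ii setUC. Qed.

(** Contracting a coloop leaves the same independent sets as deleting it, and deletion keeps exactly
    the circuits avoiding [i], which here are all of them. *)
Lemma circuit_contraction_coloop i C : coloop M i ->
  circuit (contraction M i) C = circuit M C.
Proof.
move=> coi.
have ii: [set i] \in indep M.
  by rewrite -[[set i]]setU0 coloop_indepU1 // indep_set0.
have conE D : (D \in indep (contraction M i)) = (D \subset E :\ i) && (D \in indep M).
  rewrite con_indepE //; congr (_ && _).
  apply/idP/idP => [iD|]; last exact: coloop_indepU1.
  by apply: indep_sub iD _; apply: subsetUr.
transitivity (circuit (deletion M i) C).
  by apply: eq_circuit => D; rewrite conE inE andbC.
rewrite circuit_deletion andbC; case: (boolP (circuit M C)) => [cC|]; last first.
  by rewrite andbF.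
by rewrite (coloop_notin_circuit coi cC).
Qed.

Section NonLoop.
Variables (i : T) (ii : [set i] \in indep M).

(** Which alternative occurs depends on whether [C] is dependent in [M] already or becomes so only
    after adding [i]. *)
Lemma circuit_of_contraction C : circuit (contraction M i) C ->
  i \notin C /\ (circuit M C \/ circuit M (i |: C)).
Proof.
case/circuitP=> CE nC minC; move: CE nC; rewrite subsetD1 => /andP[CE iC].
rewrite con_indepE // subsetD1 CE iC /= => nC; split=> //.
have iE : i \in E by rewrite -sub1set (indep_ground ii).
have min' D : D \proper C -> i |: D \in indep M.
  by move/minC; rewrite con_indepE // => /andP[].
case: (boolP (C \in indep M)) => [iC'|nC'].
  right; apply/circuitP; split=> //; first by rewrite subUset sub1set iE.
  move=> D; rewrite properEneq => /andP[neD sDC].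
  case: (boolP (i \in D)) => iD.
    rewrite -(setD1K iD); apply: min'.
    rewrite properEneq subDset sDC andbT.
    by apply: contra neD => /eqP <-; rewrite setD1K.
  by apply: indep_sub iC' _; rewrite -(setU1K iC) subsetD1 sDC.
left; apply/circuitP; split=> // D /min'.
by move=> iD; apply: indep_sub iD _; apply: subsetUr.
Qed.

Lemma circuit_contraction_setD1 C : circuit M C -> i \in C ->
  circuit (contraction M i) (C :\ i).
Proof.
case/circuitP=> CE nC minC iC; apply/circuitP; split; first exact: setSD.
  by rewrite con_indepE // setD1K // negb_and nC orbT.
move=> D ltD; rewrite con_indepE //.
have sD := proper_sub ltD; rewrite (subset_trans sD (setSD _ CE)) /=.
have iD : i \notin D by move: sD; rewrite subsetD1 => /andP[].
(* It remains to see that [i |: D] is a proper subset of [C]; equality would give [D = C :\ i]. *)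
apply: minC; rewrite -(setD1K iC) properEneq setUS // andbT.
apply: contraTneq ltD => eqD.
by rewrite -(setU1K iD) eqD setU1K ?properxx // setD11.
Qed.

(* With [J] a maximal subset of [C :\ m] independent in [M / i], the set
   [m |: J] is dependent in [M / i]; every circuit inside it contains [m]. *)
Lemma circuit_contraction_through C m : circuit M C -> i \notin C -> m \in C ->
  exists C', [/\ circuit (contraction M i) C', m \in C' & C' \subset C].
Proof.
case/circuitP=> CE nC minC iC mC.
have iCm : C :\ m \in indep M by apply: minC; apply: properD1.
pose P := [pred D : {set T} | (D \subset C :\ m) && (i |: D \in indep M)].
have [|J /maxsetP[/andP[sJ iJ] maxJ] _] := @maxset_exists _ P set0.
  by rewrite /= sub0set setU0.
have sJC := subset_trans sJ (subD1set C m).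
have smJC : m |: J \subset C by rewrite subUset sub1set mC.
have iNJ : i \notin J by apply: contra iC => /(subsetP sJC).
have maxJ1 x : x \in C :\ m -> x |: (i |: J) \in indep M -> x \in J.
  move=> xC; rewrite setUCA => ixJ; rewrite -(maxJ (x |: J)) ?setU11 ?subsetUr //.
  by rewrite /= subUset sub1set xC sJ.
have smJE : m |: J \subset E :\ i.
  by rewrite subsetD1 (subset_trans smJC CE); apply: contra iC => /(subsetP smJC).
have iJc : J \in indep (contraction M i).
  by rewrite con_indepE // iJ (subset_trans (subsetUr [set m] J)).
have nmJ : m |: J \notin indep (contraction M i).
  rewrite con_indepE // smJE /=; apply/negP => imJ.
  (* Otherwise augmentation extends [i |: J] by an element of [C :\ m], against the maximality of
     [J]. *)
  have leC : (#|C :\ m| <= #|i |: J|)%N.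
    rewrite leqNgt; apply/negP => lt.
    have [x] := indep_aug iJ iCm lt.
    rewrite in_setD => /andP[xN xC] /(maxJ1 x xC) xJ.
    by rewrite in_setU xJ orbT in xN.
  have ltC : (#|C :\ m| < #|i |: (m |: J)|)%N.
    rewrite setUCA cardsU1 (_ : m \notin _) ?ltnS // in_setU1 negb_or.
    rewrite (contraNneq _ iC) => [/=|<- //].
    by apply/negP => /(subsetP sJ); rewrite setD11.
  (* Augment [C :\ m] by some [x]. If [x = i], maximality gives [J = C :\ m], so [imJ] makes [C]
     independent; if [x = m], the augmented set is [C] itself; and [x] in [J] is already in
     [C :\ m]. *)
  have [x] := indep_aug iCm imJ ltC.
  rewrite !in_setD !in_setU !in_set1 => /andP[xN].
  case/or3P=> [/eqP->|/eqP->|xJ].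
  - move=> iCmi; have eqJ : C :\ m = J by apply: maxJ => //=; rewrite subxx.
    by move: imJ; rewrite -eqJ setD1K // => /indep_sub/(_ (subsetUr _ _)); apply/negP.
  - by rewrite setD1K // (negPf nC).
  - by move: xN; have := subsetP sJ _ xJ; rewrite in_setD1 => ->.
have [C' cC' sC'] := circuit_sub_dep (M := contraction M i) smJE nmJ.
have [C'E nC' _] := circuitP _ _ cC'.
exists C'; split; [exact: cC' | | exact: subset_trans sC' smJC].
(* Without [m], [C'] would lie inside [J], which is independent in [M / i]. *)
apply: contraNT nC' => mC'; apply: indep_sub iJc _.
apply/subsetP => x xC'; case/setU1P: (subsetP sC' x xC') => // xm.
by rewrite -xm xC' in mC'.
Qed.

End NonLoop.
End Matroids.

(** When no face contains the apex, membership in the cone becomes a single test, uniform in whether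
    [i] lies in [S]. *)
Lemma mem_cone (T : finType) (D : {set {set T}}) (i : T) (S : {set T}) :
  (forall U, U \in D -> i \notin U) -> (S \in cone D i) = (S :\ i \in D).
Proof.
move=> iD; rewrite inE; apply/orP/idP => [[SD|/imsetP[U UD ->]]|SD].
- by rewrite setD1_id ?iD.
- by rewrite setU1K // iD.
case: (boolP (i \in S)) => iS.
  by right; apply/imsetP; exists (S :\ i); rewrite ?setD1K.
by left; rewrite -(setD1_id iS).
Qed.

(** * How broken circuits change with [C] and [I] *)

Section BrokenCircuits.
Variables (R : realType) (T : finType) (w : T -> R).
Implicit Types (C I S : {set T}) (i : T).

Lemma broken_sub_circuit I C : broken w I C \subset C.
Proof.
rewrite /broken; case: ifP => _; first exact: subsetDl.
rewrite subUset subsetIl; apply/subsetP => x.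
by rewrite !inE => /andP[/andP[_ ->]].
Qed.

Lemma broken_setD1 I C i : i \notin C -> broken w (I :\ i) C = broken w I C.
Proof.
move=> iC; rewrite /broken subsetD1 iC andbT setIDA setDDr.
have -> : C :&: [set i] = set0.
  by apply/eqP; rewrite setI_eq0 disjoint_sym disjoints1.
by rewrite setU0 (setD1_id (i := i)) // inE negb_and iC.
Qed.

Lemma wmax_neq0 S : S != set0 -> wmax w S != set0.
Proof.
case/set0Pn=> a aS; case: (arg_maxP w aS) => x xS max_x.
by apply/set0Pn; exists x; rewrite inE; apply/andP; split=> //; apply/forall_inP.
Qed.

Lemma wmax_eq1 I i : wmax w I = [set i] -> i \in I /\ {in I, forall y, w y <= w i}.
Proof.
move=> maxI; have : i \in wmax w I by rewrite maxI set11.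
by rewrite inE => /andP[iI /forall_inP maxi].
Qed.

(** If [C] lies in [I], its minimum is also the minimum of [C'] whenever it belongs to [C'].
    Otherwise the maximum of [C :\: I] survives in [C'] and stays maximal in [C' :\: I]. *)
Lemma brokenS I C C' : C' \subset C -> wmax w (C :\: I) \subset C' ->
  broken w I C' \subset broken w I C.
Proof.
move=> sC'C smax; rewrite /broken.
case: (boolP (C \subset I)) => sCI.
  rewrite (subset_trans sC'C sCI); apply/subsetP => x.
  rewrite !inE => /andP[+ xC']; rewrite xC' (subsetP sC'C _ xC') andbT /=.
  apply: contra => /forall_inP minx; apply/forall_inP => y yC'.
  exact/minx/(subsetP sC'C).
have /set0Pn[m mmax] : wmax w (C :\: I) != set0.
  by apply: wmax_neq0; rewrite setD_eq0.
have mC' := subsetP smax m mmax.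
move: mmax; rewrite inE in_setD => /andP[/andP[mI _] /forall_inP maxm].
rewrite ifN; last by apply: contra mI => /subsetP; apply.
apply: setUSS; first exact: setSI.
apply/subsetP => x; rewrite inE in_setD => /andP[/andP[xI xC'] /forall_inP maxx].
rewrite inE in_setD xI (subsetP sC'C x xC'); apply/forall_inP => y yC.
apply: le_trans (maxm y yC) _; apply: maxx.
by rewrite in_setD mI.
Qed.

(** Since [i] is the maximum of [I], adding it to a subset [C] of [I] keeps the minimum of [C]
    minimal; and as [i] is in [I], it never changes [C :\: I]. *)
Lemma broken_setU1 I C i : wmax w I = [set i] -> i \notin C ->
  broken w I (i |: C) \subset i |: broken w I C.
Proof.
move=> maxI iC.
have [iI maxi] := wmax_eq1 maxI.
rewrite /broken subUset sub1set iI /=; case: ifP => sCI.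
  apply/subsetP => x; rewrite !inE.
  case: eqVneq => //= _ /andP[+ xC]; rewrite xC andbT /= => nmin.
  apply: contra nmin => /forall_inP minx; apply/forall_inP => y.
  case/setU1P=> [->|]; last exact: minx.
  exact/maxi/(subsetP sCI).
have -> : (i |: C) :\: I = C :\: I.
  apply/setP => x; rewrite !inE; case: eqVneq => //= ->.
  by rewrite iI.
by rewrite setUA setSU // setIUl setUSS // subsetIl.
Qed.

(** Breaking could remove [i] only as the minimum of some [C] inside [I]; being also the maximum
    there, [i] would be the only element of [C]. *)
Lemma mem_broken I C i : injective w -> wmax w I = [set i] ->
  i \in C -> C != [set i] -> i \in broken w I C.
Proof.
move=> w_inj maxI iC neC.
have [iI maxi] := wmax_eq1 maxI.
rewrite /broken; case: ifP => [/subsetP sCI|_]; last by rewrite !inE iC iI.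
rewrite !inE iC andbT; apply: contra neC => /forall_inP mini.
rewrite eqEsubset sub1set iC andbT; apply/subsetP => y yC; rewrite inE.
by apply/eqP/w_inj/le_anti; rewrite maxi ?mini ?sCI.
Qed.

Lemma broken_complexP (E : {set T}) (M : matroid E) I S :
  reflect (S \subset E /\ forall C, circuit M C -> ~~ (broken w I C \subset S))
          (S \in broken_complex w M I).
Proof.
rewrite inE; apply: (iffP andP) => -[SE H]; split=> //.
  by move=> C; apply/implyP; apply: (forallP H).
by apply/forallP => C; apply/implyP/H.
Qed.

(** * Decomposition of the broken circuit complex *)

Section Complexes.
Variables (E : {set T}) (M : matroid E).

Lemma broken_complexS I S S' :
  S' \subset S -> S \in broken_complex w M I -> S' \in broken_complex w M I.
Proof.
move=> sS'S /broken_complexP[SE nS]; apply/broken_complexP; split.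
  exact: subset_trans sS'S SE.
by move=> C /nS; apply: contra => /subset_trans; apply.
Qed.

(** The circuit [[set i]] breaks to the empty set, which every candidate face contains. *)
Lemma broken_complex_loop I i : i \in I -> loop M i -> broken_complex w M I = set0.
Proof.
move=> iI loopi; apply/setP => S; rewrite in_set0.
apply/negP => /broken_complexP[_ /(_ _ loopi)].
rewrite /broken sub1set iI.
suff -> : [set i] :\: wmin w [set i] = set0 by rewrite sub0set.
apply/eqP; rewrite setD_eq0 sub1set !inE eqxx /=.
by apply/forall_inP => y /set1P->.
Qed.

Lemma broken_complex_coloop I i : i \in E -> coloop M i ->
  broken_complex w M I =
    cone (broken_complex w (contraction M i) (I :\ i)) i.
Proof.
move=> iE coi; apply/setP => S; rewrite mem_cone; last first.
  by move=> U /broken_complexP[]; rewrite subsetD1 => /andP[].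
apply/broken_complexP/broken_complexP => -[SE nS]; split.
- exact: setSD.
- move=> C; rewrite circuit_contraction_coloop // => cC.
  rewrite broken_setD1 ?(coloop_notin_circuit coi) // subsetD1.
  by rewrite negb_and nS.
- by move: SE; rewrite subDset setD1K.
move=> C cC; have iC := coloop_notin_circuit coi cC.
move: (nS C); rewrite circuit_contraction_coloop // broken_setD1 //.
move=> /(_ cC); apply: contra => sS; rewrite subsetD1 sS /=.
by apply: contra iC => /(subsetP (broken_sub_circuit I C)).
Qed.

Section Max.
Variables (w_inj : injective w) (I : {set T}) (i : T).
Hypotheses (maxI : wmax w I = [set i]) (ii : [set i] \in indep M).

(** This identifies the link of [i] with the complex of [M / i]. *)
Lemma broken_complex_setU1 S : i \notin S ->
  (i |: S \in broken_complex w M I) =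
  (S \in broken_complex w (contraction M i) (I :\ i)).
Proof.
move=> iS; have iE : i \in E by rewrite -sub1set (indep_ground ii).
apply/broken_complexP/broken_complexP => -[SE nS]; split.
- by rewrite subsetD1 iS (subset_trans (subsetUr _ _) SE).
- move=> C cC; have [iC [cM|cM]] := circuit_of_contraction ii cC.
    rewrite broken_setD1 //; apply: contra (nS _ cM) => sb.
    exact: subset_trans sb (subsetUr _ _).
  rewrite broken_setD1 //; apply: contra (nS _ cM) => sb.
  exact: subset_trans (broken_setU1 maxI iC) (setUS _ sb).
- by rewrite subUset sub1set iE; move: SE; rewrite subsetD1 => /andP[].
move=> C cC; apply/negP => sb.
(* Passing to a circuit of the contraction that keeps the maximum of [C :\: I] lets [brokenS]
   compare the two broken circuits. *)
have [C' [cC' sC'C smax]] : exists C', [/\ circuit (contraction M i) C',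
    C' \subset C & wmax w (C :\: I) \subset C'].
  case: (boolP (i \in C)) => iC.
    exists (C :\ i); split; [exact: circuit_contraction_setD1 | exact: subD1set |].
    apply/subsetP => x; rewrite inE !in_setD in_set1 => /andP[/andP[xI ->] _].
    by rewrite andbT; apply: contraNneq xI => ->; case: (wmax_eq1 maxI).
  (* Take [m] to be the maximum of [C :\: I], or any element of [C] if that difference is empty. *)
  have [m mC maxm] : exists2 m, m \in C & wmax w (C :\: I) \subset [set m].
    have [CI|] := eqVneq (C :\: I) set0.
      have /set0Pn[m mC] := circuit_neq0 cC; exists m => //; rewrite CI.
      by apply/subsetP => x; rewrite !inE.
    case/(wmax1 w_inj)=> m em; exists m; last by rewrite em.
    have : m \in wmax w (C :\: I) by rewrite em set11.
    by rewrite !inE => /andP[/andP[]].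
  have [C' [cC' mC' sC']] := circuit_contraction_through ii cC iC mC.
  by exists C'; split=> //; apply: subset_trans maxm _; rewrite sub1set.
have [iC' _] := circuit_of_contraction ii cC'.
have /negP[] := nS _ cC'; rewrite broken_setD1 //.
have := subset_trans (brokenS sC'C smax) sb.
rewrite -subDset setD1_id //.
by apply: contra iC' => /(subsetP (broken_sub_circuit I C')).
Qed.

Lemma broken_complex_notin S : i \notin S ->
  (S \in broken_complex w M I) = (S \in broken_complex w (deletion M i) (I :\ i)).
Proof.
move=> iS; apply/broken_complexP/broken_complexP => -[SE nS]; split.
- by rewrite subsetD1 SE.
- by move=> C; rewrite circuit_deletion => /andP[cC iC]; rewrite broken_setD1 ?nS.
- by move: SE; rewrite subsetD1 => /andP[].
move=> C cC; have [iC|iC] := boolP (i \in C); last first.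
  by have := nS C; rewrite circuit_deletion cC iC broken_setD1 //; apply.
apply: contra iS => /subsetP; apply; apply: mem_broken => //.
(* A circuit is dependent, so it cannot be the independent set [[set i]]. *)
by apply: contraTneq ii => <-; case/circuitP: cC.
Qed.

Lemma broken_complex_max :
  broken_complex w M I =
    broken_complex w (deletion M i) (I :\ i)
    :|: cone (broken_complex w (contraction M i) (I :\ i)) i.
Proof.
apply/setP => S; rewrite in_setU mem_cone; last first.
  by move=> U /broken_complexP[]; rewrite subsetD1 => /andP[].
rewrite -broken_complex_setU1 ?setD11 //.
have [iS|iS] := boolP (i \in S).
  rewrite setD1K //; case: (boolP (S \in broken_complex _ (deletion M i) _)) => //.
  by case/broken_complexP; rewrite subsetD1 iS andbF.
(* For [i] outside [S] the cone contributes nothing new: if [i |: S] is a face, so is [S]. *)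
rewrite -broken_complex_notin // setD1_id //.
case: (boolP (S \in _)) => //= nS; symmetry; apply: contraNF nS.
by apply: broken_complexS; apply: subsetUr.
Qed.

End Max.
End Complexes.
End BrokenCircuits.

Theorem theorem3p2 (R : realType) (n : nat) (M : matroid [set: 'I_n])
    (I : {set 'I_n}) (w : 'rV[R]_n) (w_inj : injective (w 0)) :
  [/\ (exists2 i, i \in I & loop M i) -> broken_complex (w 0) M I = set0,
      forall i, i \in I -> coloop M i ->
        broken_complex (w 0) M I =
          cone (broken_complex (w 0) (contraction M i) (I :\ i)) i
    & forall i, wmax (w 0) I = [set i] -> ~~ loop M i -> ~~ coloop M i ->
        broken_complex (w 0) M I =
          broken_complex (w 0) (deletion M i) (I :\ i)
          :|: cone (broken_complex (w 0) (contraction M i) (I :\ i)) i].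
Proof.
split=> [[i iI loopi]|i _ coi|i maxI nloop _].
- exact: broken_complex_loop iI loopi.
- by apply: broken_complex_coloop; rewrite ?in_setT.
- by apply: broken_complex_max => //; apply: nonloop_indep; rewrite ?in_setT.
Qed.
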